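(* Let $n\ge 1$ and let $k_1,\dots,k_n\ge 1$ be integers. Let $\mathcal{M}=\{1^{k_1},2^{k_2},\ldots,n^{k_n}\}$ and $K=k_1+k_2+\cdots+k_n$. Then the number of permutations $\pi\in\overline{\mathcal{Q}}_{\mathcal{M}}$ with $des(\pi)=n$ is equal to $(K-n+1)^{n-1}$.
   Context: The notation $\{1^{k_1},\ldots,n^{k_n}\}$ denotes the multiset in which $i$ occurs exactly $k_i$ times. A permutation of a multiset is a linear arrangement (word) of its elements in which each element is used with its multiplicity. A permutation $\pi$ of a multiset is quasi-Stirling if there do not exist indices $i<j<k<\ell$ with $\pi_i=\pi_k$ and $\pi_j=\pi_\ell$. $\overline{\mathcal{Q}}_{\mathcal{M}}$ is the set of quasi-Stirling permutations of the multiset $\mathcal{M}$. For a word $\pi=\pi_1\cdots\pi_N$ of positive integers, with the convention $\pi_0=\pi_{N+1}=0$, $des(\pi)$ is the number of indices $i$, $0\le i\le N$, with $\pi_i>\pi_{i+1}$.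
   Formalization: In the definition of quasi-Stirling, the forbidden indices i<j<k<l with π_i=π_k and π_j=π_l are also required to satisfy π_i≠π_j; read literally, four equal letters would be forbidden and the count would fail for n=1, k_1=4. *)

(* Defs.v *)
From mathcomp Require Import all_boot.

Set Implicit Arguments.
Unset Strict Implicit.
Unset Printing Implicit Defensive.

(* A word arranging the multiset {1^{k_1}, ..., n^{k_n}}: the index i : 'I_n
   stands for the letter i.+1, so the multiplicity of the letter m is
   k (m - 1). *)
Definition multiset_word (n : nat) (k : 'I_n -> nat) : seq nat :=
  flatten [seq nseq (k i) (val i).+1 | i <- enum 'I_n].

(* Positions are 0-based.  The crossing letters w_i = w_k and w_j = w_l are
   required to be distinct (avoidance of the patterns 1212 and 2121), as four
   copies of the same letter are not a crossing: otherwise no word with a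
   letter of multiplicity at least 4 would be quasi-Stirling. *)
Definition quasi_stirling (w : seq nat) : bool :=
  ~~ [exists i : 'I_(size w), exists j : 'I_(size w),
      exists k : 'I_(size w), exists l : 'I_(size w),
        [&& i < j, j < k, k < l,
            nth 0 w i == nth 0 w k,
            nth 0 w j == nth 0 w l &
            nth 0 w i != nth 0 w j]].

(* [permutations s] is duplicate-free, even if [s] has repeated letters. *)
Definition quasi_stirling_permutations (n : nat) (k : 'I_n -> nat) :
    seq (seq nat) :=
  [seq w <- permutations (multiset_word k) | quasi_stirling w].

Definition des (w : seq nat) : nat :=
  let w0 := 0 :: rcons w 0 in
  #|[set i : 'I_(size w).+1 | nth 0 w0 i > nth 0 w0 i.+1]|.

(* Main.v *)
Require Import Defs.
From mathcomp Require Import all_boot zify ring.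

Set Implicit Arguments.
Unset Strict Implicit.
Unset Printing Implicit Defensive.

(** A quasi-Stirling word has a recursive structure: the [k m] copies of a
    letter [m] enclose [k m - 1] inner slots, and any other letter has all its
    copies in one of these slots or all outside of them; the whole word is one
    more, outer, slot.  So such a word amounts to a forest in which each letter
    is a child of one of the K - n + 1 slots, with a linear order on the
    children of each slot.  If the children
    of a slot of [m] are a_1, ..., a_r in this order, the slot contributes the
    cyclic descents of m, a_1, ..., a_r, of which there are at most [r]; for
    the outer slot [m] is 0.  Hence des is at most [n], and equality holds
    exactly when in every slot this cyclic sequence is decreasing up to
    rotation, which leaves a single order of the children.  The words to be counted are therefore the
    acyclic assignments of a slot to each letter, and the weighted form of
    Cayley's formula counts (K - n + 1)^(n - 1) of them.

    The proof carries out both steps by one recursion, on lists of gaps (a gap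
    is a pair of letters bounding a slot) to be filled with words.  Cutting a
    word at the copies of its last letter ([glue]) turns its gap into several
    ones; [quasi_stirling_glue] and [nc_filling_glue] say that noncrossing
    fillings correspond under this, [gap_des_le] is the bound for descents and
    [mem_max_fillings] describes equality.

    For the count, gaps with equal ends accept every letter, while a gap
    [(c, m)] accepts the letters met before [m] when going down cyclically from
    [c]; only the first gap of a list may have distinct ends.  If [p > 0]
    letters are still to be placed and X is the sum of [(k a).-1] over them, [s]
    gaps with equal ends have s (s + X)^(p-1) extremal fillings, and
    [count_law] extends this formula to an additional restricted gap, in a form
    that satisfies a deletion and contraction recurrence over its admissible letters ([count_law_add],
    [count_law_threshold]). *)

(** * Quasi-Stirling words as pattern avoidance *)

Lemma subseq_consP (x : nat) (s w : seq nat) :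
  reflect (exists2 i, i < size w & nth 0 w i = x /\ subseq s (drop i.+1 w))
          (subseq (x :: s) w).
Proof.
elim: w => [|y w IHw] /=; first by right=> -[].
apply: (iffP idP).
- case: eqP => [<- sw | _ /IHw[i ltiw xsw]]; last by exists i.+1.
  by exists 0; rewrite // drop0.
- case=> -[|i] ltiw /= [xE sw]; first by rewrite xE eqxx; rewrite drop0 in sw.
  have xsw: subseq (x :: s) w by apply/IHw; exists i.
  case: ifP => // _; exact: subseq_trans (subseq_cons s x) xsw.
Qed.

Lemma subseq_dropP (x : nat) (s w : seq nat) (m : nat) :
  reflect (exists2 i, m <= i < size w & nth 0 w i = x /\ subseq s (drop i.+1 w))
          (subseq (x :: s) (drop m w)).
Proof.
apply: (iffP (subseq_consP _ _ _)) => -[i lti [xE sw]].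
- exists (m + i); first by move: lti; rewrite size_drop; lia.
  by move: xE sw; rewrite nth_drop drop_drop addSn (addnC i).
- exists (i - m); first by rewrite size_drop; lia.
  case/andP: lti => lemi _.
  by rewrite nth_drop drop_drop addSn subnK ?subnKC.
Qed.

Lemma subseq_cat_split (s u v : seq nat) : subseq s (u ++ v) ->
  exists s1 s2, [/\ s = s1 ++ s2, subseq s1 u & subseq s2 v].
Proof.
case/subseqP=> m szm ->; exists (mask (take (size u) m) u).
exists (mask (drop (size u) m) v); split; try exact: mask_subseq.
rewrite -mask_cat ?cat_take_drop // size_takel //.
by rewrite szm size_cat leq_addr.
Qed.

Lemma quasi_stirlingP (w : seq nat) :
  reflect (forall b c : nat, b != c -> ~~ subseq [:: b; c; b; c] w)
          (quasi_stirling w).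
Proof.
apply: (iffP negP) => [ncr b c neq | ncr].
- apply/negP; rewrite -[w]drop0 => /subseq_dropP[i lti [bi]].
  case/subseq_dropP=> j ltj [cj] /subseq_dropP[k ltk [bk]].
  case/subseq_dropP=> l ltl [cl _].
  have [iw jw kw lw]: [/\ i < size w, j < size w, k < size w & l < size w].
    by split; [case/andP: lti | case/andP: ltj | case/andP: ltk | case/andP: ltl].
  apply: ncr; apply/existsP; exists (Ordinal iw).
  apply/existsP; exists (Ordinal jw); apply/existsP; exists (Ordinal kw).
  apply/existsP; exists (Ordinal lw) => /=.
  case/andP: ltj => -> _; case/andP: ltk => -> _; case/andP: ltl => -> _.
  by rewrite bi cj bk cl neq !eqxx.
- case/existsP=> i /existsP[j] /existsP[k] /existsP[l].
  case/and5P=> ij jk kl /eqP ik /andP[/eqP jl neq].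
  move: (ncr _ _ neq); apply/negP; rewrite negbK -[X in subseq _ X]drop0.
  apply/subseq_dropP; exists i; [exact: ltn_ord | split => //].
  apply/subseq_dropP; exists j; first by rewrite ij ltn_ord.
  split => //; apply/subseq_dropP; exists k; first by rewrite jk ltn_ord.
  split => //; apply/subseq_dropP; exists l; first by rewrite kl ltn_ord.
  by split; rewrite ?sub0seq.
Qed.

(** * Cutting a word at the copies of its last letter *)

(** Every nonempty word is uniquely [glue a ws], with [a] its last letter and
    no [a] inside [ws].  Cutting at the last letter, rather than the first,
    puts the part preceding all the [a]'s at the head of [ws]. *)
Definition glue (a : nat) (ws : seq (seq nat)) : seq nat :=
  flatten [seq rcons w a | w <- ws].

Definition disj (u v : seq nat) : bool := ~~ has (mem u) v.

Lemma glue_cons (a : nat) (w : seq nat) (ws : seq (seq nat)) :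
  glue a (w :: ws) = w ++ a :: glue a ws.
Proof. by rewrite /glue /= cat_rcons. Qed.

Lemma mem_glue (a : nat) (ws : seq (seq nat)) (x : nat) :
  (x \in glue a ws) = ((0 < size ws) && (x == a)) || has (fun w => x \in w) ws.
Proof.
elim: ws => //= w ws IH; rewrite glue_cons mem_cat inE IH.
by case: (x \in w); case: (x == a); rewrite ?orbT //= andbF.
Qed.

Lemma count_glue (a : nat) (ws : seq (seq nat)) (x : nat) :
  count_mem x (glue a ws) = count_mem x (flatten ws) + (a == x) * size ws.
Proof.
elim: ws => [|w ws IH]; first by rewrite muln0.
by rewrite glue_cons /= !count_cat /= IH mulnS -addnA; congr (_ + _); rewrite addnCA.
Qed.

Lemma disjP (u v : seq nat) : reflect (forall x, x \in u -> x \in v -> False) (disj u v).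
Proof.
apply: (iffP hasPn) => [h x xu xv | h x xv].
- by move: (h x xv); rewrite inE xu.
- by apply/negP => xu; exact: (h x).
Qed.

Lemma disj_glue (a : nat) (ws : seq (seq nat)) (v : seq nat) : 0 < size ws ->
  disj (glue a ws) v = (a \notin v) && all (disj^~ v) ws.
Proof.
move=> ws0; apply/disjP/andP => [h | [av /allP h] x].
- split; first by apply/negP; apply: h; rewrite mem_glue ws0 eqxx.
  apply/allP => w wws; apply/disjP => x xw; apply: h.
  by rewrite mem_glue; apply/orP; right; apply/hasP; exists w.
- rewrite mem_glue; case/orP => [/andP[_ /eqP ->] xv | /hasP[w wws xw]].
    by rewrite xv in av.
  by apply: (disjP _ _ (h w wws)).
Qed.

(** A pattern whose two halves share a letter, wherever it is cut, cannot
    straddle two words without common letters. *)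
Lemma subseq_cat_disj (s u v : seq nat) :
  disj u v -> (forall i, 0 < i < size s -> ~~ disj (take i s) (drop i s)) ->
  subseq s (u ++ v) -> subseq s u \/ subseq s v.
Proof.
move=> /disjP uv lnk /subseq_cat_split[s1 [s2 [sE s1u s2v]]].
have [s1_0 | s1_gt0] := posnP (size s1).
  by right; rewrite sE (size0nil s1_0).
have [s2_0 | s2_gt0] := posnP (size s2).
  by left; rewrite sE (size0nil s2_0) cats0.
have /lnk: 0 < size s1 < size s by rewrite sE size_cat; lia.
rewrite sE take_size_cat // drop_size_cat //; case/negP; apply/disjP => x xs1 xs2.
by apply: (uv x); [exact: (mem_subseq s1u) | exact: (mem_subseq s2v)].
Qed.

Lemma disj_cons_glue (a : nat) (w : seq nat) (ws : seq (seq nat)) :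
  all (fun w' => a \notin w') (w :: ws) -> all (disj w) ws ->
  disj w (a :: glue a ws).
Proof.
move=> /= /andP[aw _] /allP dw; apply/disjP => x xw.
rewrite inE => /orP[/eqP xa|]; first by rewrite -xa xw in aw.
rewrite mem_glue => /orP[/andP[_ /eqP xa]|/hasP[w' w'ws xw']].
  by rewrite -xa xw in aw.
exact: (disjP _ _ (dw _ w'ws)) xw xw'.
Qed.

Lemma glue_no_return (a c : nat) (ws : seq (seq nat)) : all (fun w => a \notin w) ws ->
  pairwise disj ws -> a != c -> ~~ subseq [:: c; a; c] (glue a ws).
Proof.
elim: ws => [|w ws IH] //; move=> aws /= /andP[dw dws] ac.
have aw: a \notin w by case/andP: aws.
have dwg := disj_cons_glue aws dw.
rewrite glue_cons; apply/negP => /(subseq_cat_disj dwg)[].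
- case=> [|[|[|i]]] //= _; rewrite /disj /= !inE !eqxx ?orbT //.
- by move/mem_subseq/(_ a); rewrite !inE eqxx orbT (negPf aw) => /(_ isT).
- rewrite /= eq_sym (negPf ac); apply/negP/IH => //; by case/andP: aws.
Qed.

(** A letter [x] common to two parts would give [x a x a], as every part is
    followed by an [a].  Conversely, with disjoint parts an occurrence of
    [b c b c] with [b] and [c] other than [a] lies inside one part, and one
    involving [a] would have a letter occurring on both sides of an [a]. *)
Lemma quasi_stirling_glue (a : nat) (ws : seq (seq nat)) : all (fun w => a \notin w) ws ->
  quasi_stirling (glue a ws) = all quasi_stirling ws && pairwise disj ws.
Proof.
move=> aws; apply/idP/andP.
- move/quasi_stirlingP; elim: ws aws => [|w ws IH] //= /andP[aw aws].
  rewrite glue_cons => ncr.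
  have suf: subseq (glue a ws) (w ++ a :: glue a ws).
    by rewrite -cat_rcons suffix_subseq.
  have [|-> ->] := IH aws.
    by move=> b c neq; apply: contra (ncr b c neq) => /subseq_trans; apply.
  rewrite !andbT; split.
    apply/quasi_stirlingP => b c neq; apply: contra (ncr b c neq).
    by move/subseq_trans; apply; apply: prefix_subseq.
  apply/allP => w' w'ws; apply/disjP => x xw xw'.
  have xa: x != a by apply: contraNneq aw => <-.
  move: (ncr x a xa); apply/negP; rewrite negbK.
  apply: (@cat_subseq _ [:: x] [:: a; x; a]); first by rewrite sub1seq.
  rewrite /= eqxx.
  case/splitPr: w'ws => ws1 ws2; rewrite /glue map_cat flatten_cat /=.
  apply: (@cat_subseq _ [::] [:: x; a]); first exact: sub0seq.
  apply: (@cat_subseq _ [:: x; a] [::] _ _ _ (sub0seq _)) => //.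
  by rewrite -cats1; apply: (@cat_subseq _ [:: x] [:: a]); [rewrite sub1seq | rewrite /= eqxx].
- case=> qs dis; apply/quasi_stirlingP.
  elim: ws aws qs dis => [|w ws IH] //= /andP[aw aws].
  case/andP=> /quasi_stirlingP qw qs /andP[dw dis] b c neq.
  have dwg: disj w (a :: glue a ws) by apply: disj_cons_glue => //=; rewrite aw.
  rewrite glue_cons; apply/negP => /(subseq_cat_disj dwg)[].
  + by case=> [|[|[|[|i]]]] //= _; rewrite /disj /= !inE !eqxx ?orbT.
  + exact/negP/qw.
  + case: (eqVneq b a) => [ba | ba].
      rewrite ba /= eqxx; apply/negP/glue_no_return => //.
      by rewrite -ba.
    by rewrite /= (negPf ba); apply/negP/IH.
Qed.

Lemma glue_inj (a : nat) (ws ws' : seq (seq nat)) : size ws = size ws' ->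
  all (fun w => a \notin w) ws -> all (fun w => a \notin w) ws' ->
  glue a ws = glue a ws' -> ws = ws'.
Proof.
elim: ws ws' => [|w ws IH] [|w' ws'] //= [sz] /andP[aw aws] /andP[aw' aws'].
rewrite !glue_cons => E.
have ww': w = w'.
  have := congr1 (fun s => take (index a s) s) E.
  by rewrite !index_cat (negPf aw) (negPf aw') /= eqxx !addn0 !take_size_cat.
rewrite ww' in E *; congr (_ :: _); apply: IH => //.
by move/eqP: E; rewrite eqseq_cat // eqxx /= eqseq_cons eqxx => /eqP.
Qed.

Lemma glue_split (a : nat) (w : seq nat) : exists ws t,
  [/\ w = glue a ws ++ t, all (fun w' => a \notin w') ws & a \notin t].
Proof.
elim: w => [|x w [ws [t [-> aws at_]]]]; first by exists [::], [::].
have [-> | xa] := eqVneq x a; first by exists ([::] :: ws), t.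
case: ws aws => [|w' ws] /= aws.
  by exists [::], (x :: t); rewrite inE negb_or eq_sym xa.
exists ((x :: w') :: ws), t; rewrite !glue_cons /= inE negb_or eq_sym xa.
by split.
Qed.

(** * Descents in gaps *)

(** The convention of a letter 0 at both ends is the case [c = m = 0]; general
    ends are needed because a word is cut at its own letters. *)
Definition ndes (c : nat) (w : seq nat) (m : nat) : nat :=
  sumn (pairmap (fun x y => nat_of_bool (y < x)) c (rcons w m)).

Lemma ndes_cat (c a m : nat) (u v : seq nat) :
  ndes c (u ++ a :: v) m = ndes c u a + ndes a v m.
Proof.
by rewrite /ndes -cat_rcons rcons_cat pairmap_cat sumn_cat last_rcons.
Qed.

Lemma ndes0 (c m : nat) : ndes c [::] m = (m < c).
Proof. by rewrite /ndes /= addn0. Qed.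

Lemma ndes_cons (c x m : nat) (w : seq nat) :
  ndes c (x :: w) m = (x < c) + ndes x w m.
Proof. by []. Qed.

Lemma desE (w : seq nat) : des w = ndes 0 w 0.
Proof.
rewrite /des cardsE -sum1_card big_mkcond /=.
have descE c m : \sum_(i < (size w).+1)
    (if nth 0 (c :: rcons w m) i > nth 0 (c :: rcons w m) i.+1 then 1 else 0)
    = ndes c w m.
  elim: w c => [|x w IH] c; first by rewrite big_ord_recl big_ord0 ndes0 /=; case: ltnP.
  rewrite big_ord_recl ndes_cons -IH /=.
  by congr (_ + _); case: ltnP.
rewrite -descE; apply: eq_bigr => i _; by rewrite unfold_in.
Qed.

(** A gap is a pair (letter on its left, letter on its right), to be filled
    with a word. *)
Definition gap_des (gs : seq (nat * nat)) (us : seq (seq nat)) : nat :=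
  \sum_(p <- zip gs us) ndes p.1.1 p.2 p.1.2.

Definition base_des (gs : seq (nat * nat)) : nat :=
  \sum_(g <- gs) (g.2 < g.1).

(** The gaps left when a gap [(c, m)] is filled with a word ending in [a],
    of which the [k a] copies of [a] are written down.  The gap between the
    last [a] and [m] stays empty and is dropped. *)
Definition open_gap (k : nat -> nat) (c a : nat) (gs : seq (nat * nat)) :=
  (c, a) :: nseq (k a).-1 (a, a) ++ gs.

Lemma gap_des_cons (c m : nat) (gs : seq (nat * nat)) (u : seq nat) (us : seq (seq nat)) :
  gap_des ((c, m) :: gs) (u :: us) = ndes c u m + gap_des gs us.
Proof. by rewrite /gap_des /= big_cons. Qed.

Lemma base_des_cons (c m : nat) (gs : seq (nat * nat)) :
  base_des ((c, m) :: gs) = (m < c) + base_des gs.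
Proof. by rewrite /base_des big_cons. Qed.

Lemma gap_des_glue (k : nat -> nat) (c a m : nat) (gs : seq (nat * nat))
    (ws us : seq (seq nat)) : 0 < k a -> size ws = k a ->
  gap_des ((c, m) :: gs) (glue a ws :: us)
  = gap_des (open_gap k c a gs) (ws ++ us) + (m < a).
Proof.
case: ws => [|w ws] /= ka szws; first by rewrite -szws in ka.
rewrite gap_des_cons /open_gap /= gap_des_cons -szws /= glue_cons ndes_cat.
rewrite /gap_des zip_cat ?size_nseq // big_cat /= -!addnA; congr (_ + _).
rewrite [X in _ = _ + X]addnC addnA; congr (_ + _).
elim: ws {w ka szws} => [|w ws IH]; first by rewrite ndes0 big_nil.
by rewrite glue_cons ndes_cat IH /= big_cons addnA.
Qed.

Lemma base_des_open (k : nat -> nat) (c a : nat) (gs : seq (nat * nat)) :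
  base_des (open_gap k c a gs) = (a < c) + base_des gs.
Proof.
rewrite /base_des big_cons big_cat /= big1_seq ?add0n // => g /= gn.
by move: gn; rewrite mem_nseq => /andP[_ /eqP ->] /=; rewrite ltnn.
Qed.

Lemma size_open_gap (k : nat -> nat) (c a : nat) (gs : seq (nat * nat)) :
  0 < k a -> size (open_gap k c a gs) = k a + size gs.
Proof. by rewrite /= size_cat size_nseq; lia. Qed.

(** * Noncrossing fillings *)

Lemma count_flatten0 (x : nat) (us : seq (seq nat)) :
  count_mem x (flatten us) = 0 -> all (fun w => x \notin w) us.
Proof.
move/count_memPn => xus; apply/allP => w wus; apply: contra xus => xw.
by apply/flattenP; exists w.
Qed.

(** The fillings of a list of gaps by quasi-Stirling words that use exactly the
    letters of [A], each in one of the gaps only.  Disjointness is what the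
    absence of crossings with the letters bounding the gaps amounts to. *)
Definition nc_filling (k : nat -> nat) (A : seq nat)
    (us : seq (seq nat)) : Prop :=
  [/\ forall x : nat, count_mem x (flatten us) = if x \in A then k x else 0,
      all quasi_stirling us & pairwise disj us].

Lemma nc_filling_empty_word (k : nat -> nat) (A : seq nat) (us : seq (seq nat)) :
  nc_filling k A ([::] :: us) <-> nc_filling k A us.
Proof.
have qs0 : quasi_stirling [::] by apply/quasi_stirlingP.
have d0 : all (disj [::]) us by apply/allP => u _; apply/disjP.
by rewrite /nc_filling /= qs0 d0.
Qed.

(** Cutting the first word preserves the notion: disjointness of the parts from
    one another and from the remaining words is the same as noncrossing. *)
Lemma nc_filling_glue (k : nat -> nat) (A : seq nat) (a : nat) (ws us : seq (seq nat)) :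
  uniq A -> a \in A -> 0 < k a -> size ws = k a ->
  nc_filling k A (glue a ws :: us) <->
  nc_filling k (rem a A) (ws ++ us).
Proof.
move=> uA aA ka szws.
have ws0 : 0 < size ws by rewrite szws.
have cnt x : count_mem x (flatten (glue a ws :: us))
    = count_mem x (flatten (ws ++ us)) + (a == x) * k a.
  by rewrite flatten_cat /= !count_cat count_glue szws addnAC.
have free : (forall x : nat, count_mem x (flatten (ws ++ us))
                       = if x \in rem a A then k x else 0) ->
    all (fun w => a \notin w) ws /\ all (fun w => a \notin w) us.
  move=> /(_ a); rewrite mem_rem_uniq // inE eqxx /= => /count_flatten0.
  by rewrite all_cat => /andP.
have cntE : (forall x : nat, count_mem x (flatten (glue a ws :: us))
                       = if x \in A then k x else 0) <->
            (forall x : nat, count_mem x (flatten (ws ++ us))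
                       = if x \in rem a A then k x else 0).
  split=> h x; have := h x; rewrite cnt mem_rem_uniq // inE;
    case: (eqVneq x a) => [-> | xa] /=; rewrite ?eqxx ?aA ?mul1n ?mul0n ?addn0.
  - by move/(canRL (addnK _)); rewrite subnn.
  - by [].
  - by move=> ->.
  - by [].
rewrite /nc_filling all_cat pairwise_cat /=.
have dg : all (fun w => a \notin w) us ->
    all (disj (glue a ws)) us = allrel disj ws us.
  move=> aus; rewrite allrelC /allrel; apply: eq_in_all => v vus.
  by rewrite disj_glue // (allP aus v vus).
split=> -[h].
- have h' := cntE.1 h; have [aws aus] := free h'.
  by rewrite quasi_stirling_glue ?dg // => /andP[/andP[-> ->] ->] /andP[-> ->].
- have h' := cntE.2 h; have [aws aus] := free h.
  by rewrite quasi_stirling_glue ?dg // => /andP[-> ->] /and3P[-> -> ->].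
Qed.

Lemma nc_filling_cons (k : nat -> nat) (A : seq nat) (u : seq nat) (us : seq (seq nat)) :
  uniq A -> (forall a : nat, a \in A -> 0 < k a) ->
  nc_filling k A (u :: us) ->
  u = [::] \/ exists (a : nat) (ws : seq (seq nat)),
    [/\ a \in A, size ws = k a & u = glue a ws].
Proof.
move=> uA kA [cnt _ dis].
case/lastP: u cnt dis => [|u a] cnt dis; [by left | right].
have [ws [t [E aws at_]]] := glue_split a (rcons u a).
have t0 : t = [::].
  case/lastP: t E at_ => // t b; rewrite -rcons_cat => /rcons_inj[_ <-].
  by rewrite mem_rcons inE eqxx.
rewrite t0 cats0 in E.
have aA : a \in A.
  have := cnt a; case: ifP => // _ /eqP; rewrite -leqn0 leqNgt -has_count.
  by move/hasPn/(_ a) => /=; rewrite mem_cat mem_rcons !inE eqxx => /(_ isT).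
have zero s : a \notin s -> count_mem a s = 0 by move/count_memPn.
exists a, ws; split=> //.
have := cnt a; rewrite aA /= count_cat E count_glue eqxx mul1n.
rewrite (zero (flatten ws)); last first.
  by apply/negP => /flattenP[w /(allP aws)/negP].
rewrite (zero (flatten us)) ?addn0 //.
apply/negP => /flattenP[v vus av]; move: dis => /= /andP[/allP/(_ v vus)/disjP d _].
by apply: (d a) => //; rewrite mem_rcons inE eqxx.
Qed.

(** * Fillings with the maximal number of descents *)

(** By [descents_le] this is the extremal case: the letter [a], put between
    [c] and [m], adds one descent to the comparison of [c] with [m].  It means
    that [a] is met before [m] when going down cyclically from [c]. *)
Definition descending (c a m : nat) : bool := (a < c) + (m < a) == (m < c).+1.

Lemma descents_le (c a m : nat) : (a < c) + (m < a) <= (m < c).+1.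
Proof. by case: (ltnP a c); case: (ltnP m a); case: (ltnP m c); lia. Qed.

(** The measure of the recursion on fillings: it drops by one both when a gap is
    filled with the empty word and when the [k a] copies of a letter are
    written down, as this creates [(k a).-1] new gaps. *)
Definition weight (k : nat -> nat) (gs : seq (nat * nat)) (A : seq nat) : nat :=
  size gs + \sum_(a <- A) k a.

Lemma weight_open (k : nat -> nat) (c a m : nat) (gs : seq (nat * nat)) (A : seq nat) :
  0 < k a -> a \in A ->
  weight k ((c, m) :: gs) A = (weight k (open_gap k c a gs) (rem a A)).+1.
Proof.
move=> ka aA; rewrite /weight (big_rem a aA) size_open_gap //=; lia.
Qed.

Lemma nc_filling_no_gap (k : nat -> nat) (A : seq nat) :
  (forall a : nat, a \in A -> 0 < k a) -> nc_filling k A [::] -> A = [::].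
Proof.
case: A => // a A /(_ a); rewrite inE eqxx => /(_ isT) ka [/(_ a)] /=.
by rewrite inE eqxx /= => k0; rewrite -k0 in ka.
Qed.

(** Each letter contributes at most one descent.  For the gaps [[:: (0, 0)]]
    this bounds the descents of a quasi-Stirling word by its number of distinct
    letters, so the words to be counted are the extremal ones. *)
Lemma gap_des_le (k : nat -> nat) (gs : seq (nat * nat)) (A : seq nat) (us : seq (seq nat)) :
  uniq A -> (forall a : nat, a \in A -> 0 < k a) -> size us = size gs ->
  nc_filling k A us -> gap_des gs us <= size A + base_des gs.
Proof.
have [f] := ubnP (weight k gs A); elim: f gs A us => // f IH.
case=> [|[c m] gs] A us lef uA kA; first by case: us; rewrite // /gap_des big_nil.
case: us => [|u us] // [szus] ncf.
have [u0 | [a [ws [aA szws uE]]]] := nc_filling_cons uA kA ncf.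
  rewrite u0 in ncf *; move/nc_filling_empty_word: ncf => ncf.
  rewrite gap_des_cons ndes0 base_des_cons addnCA leq_add2l.
  exact: IH.
have ka := kA a aA; rewrite uE in ncf *.
move/(nc_filling_glue us uA aA ka szws): ncf => ncf.
have szwu : size (ws ++ us) = size (open_gap k c a gs).
  by rewrite size_cat size_open_gap // szws szus.
rewrite (weight_open c m _ ka aA) ltnS in lef.
have := IH _ _ _ lef (rem_uniq a uA) (fun b bA => kA b (mem_rem bA)) szwu ncf.
rewrite (gap_des_glue _ _ _ _ ka) // base_des_open size_rem //.
rewrite base_des_cons; have := descents_le c a m.
have : 0 < size A by case: (A) aA.
by move=> /=; lia.
Qed.

(** All fillings attaining the bound [gap_des_le], with [f] as fuel: the first
    gap is left empty, or the last letter of its word is some [a] for which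
    [descents_le] is an equality. *)
Fixpoint max_fillings (k : nat -> nat) (f : nat) (gs : seq (nat * nat)) (A : seq nat) :
    seq (seq (seq nat)) :=
  match f, gs with
  | _, [::] => if A is [::] then [:: [::]] else [::]
  | 0, _ :: _ => [::]
  | f'.+1, (c, m) :: gs' =>
      [seq [::] :: us | us <- max_fillings k f' gs' A] ++
      [seq glue a (take (k a) us) :: drop (k a) us
         | a <- [seq a <- A | descending c a m],
           us <- max_fillings k f' (open_gap k c a gs') (rem a A)]
  end.

(** The bound for a filling is the sum of the bound for the cut filling and of
    [descents_le], so equality must hold in both. *)
Lemma mem_max_fillings (k : nat -> nat) (f : nat) (gs : seq (nat * nat))
    (A : seq nat) (us : seq (seq nat)) :
  uniq A -> (forall a : nat, a \in A -> 0 < k a) -> weight k gs A <= f ->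
  us \in max_fillings k f gs A <->
  [/\ size us = size gs, nc_filling k A us
    & gap_des gs us = size A + base_des gs].
Proof.
have no_gap g B vs : (forall a : nat, a \in B -> 0 < k a) ->
    vs \in max_fillings k g [::] B <-> [/\ size vs = 0, nc_filling k B vs
      & gap_des [::] vs = size B + base_des [::]].
  move=> kB; split; last first.
    by case: vs => [|v vs] [] // _ /(nc_filling_no_gap kB) ->; case: g.
  case: g => [|g]; case: B kB => //= _; rewrite inE => /eqP ->; split=> //.
  - by rewrite /gap_des /base_des !big_nil.
  - by rewrite /gap_des /base_des !big_nil.
elim: f gs A us => [|f IH] [|[c m] gs] A us uA kA lef; try exact: no_gap.
  by [].
have wt0 : weight k gs A <= f by exact: lef.
have wt a : a \in A -> weight k (open_gap k c a gs) (rem a A) <= f.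
  by move=> aA; rewrite (weight_open c m _ (kA a aA) aA) in lef.
have kr a b : b \in rem a A -> 0 < k b by move/mem_rem/kA.
have ur a := rem_uniq a uA.
rewrite [max_fillings _ _ _ _]/= mem_cat; split.
- case/orP=> [/mapP[vs vsg ->] | /allpairsPdep[a [vs []]]].
    have [szvs ncf dE] := (IH gs A vs uA kA wt0).1 vsg.
    split; [by rewrite /= szvs | exact/nc_filling_empty_word |].
    by rewrite gap_des_cons dE ndes0 base_des_cons addnCA.
  rewrite mem_filter => /andP[/eqP dsc aA].
  have ka := kA a aA.
  case/(IH _ _ vs (ur a) (@kr a) (wt a aA)) => szvs ncf dE ->.
  rewrite size_open_gap // in szvs.
  have szt : size (take (k a) vs) = k a by rewrite size_takel // szvs leq_addr.
  split.
  + by rewrite /= size_drop szvs addKn.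
  + by apply/nc_filling_glue; rewrite ?cat_take_drop.
  + rewrite (gap_des_glue _ _ _ _ ka) // cat_take_drop dE base_des_open.
    rewrite size_rem // base_des_cons /=.
    have : 0 < size A by case: (A) aA.
    lia.
- case: us => [|u us] [] // [szus] ncf dE; apply/orP.
  have [u0 | [a [ws [aA szws uE]]]] := nc_filling_cons uA kA ncf.
    left; rewrite u0 in ncf dE *; apply: map_f; apply/(IH gs A us uA kA wt0).
    split=> //; first exact/nc_filling_empty_word/ncf.
    move: dE; rewrite gap_des_cons ndes0 base_des_cons /=; lia.
  right; have ka := kA a aA; rewrite uE in ncf dE *.
  move/(nc_filling_glue us uA aA ka szws): ncf => ncf.
  have szwu : size (ws ++ us) = size (open_gap k c a gs).
    by rewrite size_cat size_open_gap // szws szus.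
  have le := gap_des_le (ur a) (@kr a) szwu ncf.
  have dle := descents_le c a m.
  have A0 : 0 < size A by case: (A) aA.
  rewrite (gap_des_glue _ _ _ _ ka) // base_des_cons /= in dE.
  rewrite base_des_open size_rem //= in le.
  apply/allpairsPdep; exists a, (ws ++ us); split.
  + by rewrite mem_filter aA andbT /descending; apply/eqP; lia.
  + apply/(IH _ _ _ (ur a) (@kr a) (wt a aA)); split=> //.
    by rewrite base_des_open size_rem //=; lia.
  + by rewrite take_size_cat // drop_size_cat.
Qed.

Lemma max_fillings_uniq (k : nat -> nat) (f : nat) (gs : seq (nat * nat)) (A : seq nat) :
  uniq A -> (forall a : nat, a \in A -> 0 < k a) -> weight k gs A <= f ->
  uniq (max_fillings k f gs A).
Proof.
elim: f gs A => [|f IH] [|[c m] gs] A uA kA lef //=; try by case: (A).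
have wt0 : weight k gs A <= f by exact: lef.
have wt a : a \in A -> weight k (open_gap k c a gs) (rem a A) <= f.
  by move=> aA; rewrite (weight_open c m _ (kA a aA) aA) in lef.
have kr a b : b \in rem a A -> 0 < k b by move/mem_rem/kA.
have ur a := rem_uniq a uA.
rewrite cat_uniq map_inj_uniq ?IH //=; last by move=> ? ? [].
have spec a vs : a \in [seq a <- A | descending c a m] ->
    vs \in max_fillings k f (open_gap k c a gs) (rem a A) ->
  [/\ 0 < k a, size (take (k a) vs) = k a
    & all (fun w => a \notin w) (take (k a) vs)].
  rewrite mem_filter => /andP[_ aA]; have ka := kA a aA.
  case/(mem_max_fillings vs (ur a) (@kr a) (wt a aA)) => szvs [cnt _ _] _.
  split=> //; first by rewrite size_takel // szvs size_open_gap // leq_addr.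
  have := cnt a; rewrite mem_rem_uniq // inE eqxx /= => /count_flatten0.
  by rewrite -{1}(cat_take_drop (k a) vs) all_cat => /andP[].
have lastE a vs : 0 < k a -> size (take (k a) vs) = k a ->
    last 0 (glue a (take (k a) vs)) = a /\ glue a (take (k a) vs) != [::].
  move=> ka; case/lastP: (take _ _) => [|ws w] sz; first by rewrite -sz in ka.
  rewrite /glue map_rcons flatten_rcons last_cat last_rcons.
  by case: (flatten _) => //; case: w {sz}.
apply/andP; split.
  apply/hasPn => us /allpairsPdep[a [vs [aE vsg ->]]].
  have [ka szt _] := spec _ _ aE vsg; have [_ /eqP ne] := lastE _ _ ka szt.
  by apply/mapP => -[ws _ [/ne]].
apply: allpairs_uniq_dep; first exact: filter_uniq.
  move=> a; rewrite mem_filter => /andP[_ aA].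
  exact: IH (ur a) (@kr a) (wt a aA).
move=> _ _ /allpairsPdep[a [vs [aE vsg ->]]] /allpairsPdep[b [ws [bE wsg ->]]] /=.
have [ka sza fa] := spec _ _ aE vsg; have [kb szb fb] := spec _ _ bE wsg.
case=> gE dE.
have ab : a = b.
  by rewrite -(lastE _ _ ka sza).1 gE (lastE _ _ kb szb).1.
rewrite -ab in gE dE szb fb wsg bE *; congr Tagged.
rewrite -(cat_take_drop (k a) vs) -(cat_take_drop (k a) ws) dE; congr (_ ++ _).
by apply: glue_inj gE; rewrite // sza.
Qed.

(** * Counting the maximal fillings *)

(** Division-free form of
      N = (Y + 1)^(e-1) * ((s + 1) * Y^q - R * Y^(q-1)).
    Here N is the number of maximal fillings of one special gap and of [s] gaps
    with equal ends, the letters split into [e] that may be used at the top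
    level of the special gap and [q] that may not, [R] is the sum of
    [(k b).-1] over the latter, and Y is [s] plus that sum over all letters.
    The exponent [q.-1] at [q = 0] is harmless since then [R = 0]. *)
Definition count_law (Y s N e q R : nat) : Prop :=
  N * Y.+1 + Y.+1 ^ e * (R * Y ^ q.-1) = Y.+1 ^ e * (s.+1 * Y ^ q).

(** Deletion and contraction of one letter, allowed at the top level of the
    special gap: it is not used there, which makes it one of the [q] others, or
    it is, which replaces it by [x] new gaps.  The parameter Y is the same in
    the three terms. *)
Lemma count_law_add (Y s x N N' e q R : nat) : (q = 0 -> R = 0) ->
  count_law Y s N e q.+1 (R + x) -> count_law Y (s + x) N' e q R ->
  count_law Y s (N + N') e.+1 q R.
Proof.
rewrite /count_law; case: q => [/(_ erefl) -> | q _] /=.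
  rewrite !expn1 !expn0 expnS (mulnDl N N').
  by move: (Y.+1 ^ e) => P; nia.
rewrite !expnS (mulnDl N N'); move: (Y.+1 ^ e) (Y ^ q) (N * _) (N' * _) => P T B C.
have -> : P * ((R + x) * (Y * T)) = R * (Y * (P * T)) + x * (Y * (P * T)) by ring.
have -> : P * (s.+1 * (Y * (Y * T))) = s.+1 * Y * (Y * (P * T)) by ring.
have -> : P * (R * T) = R * (P * T) by ring.
have -> : P * ((s + x).+1 * (Y * T))
    = s.+1 * (Y * (P * T)) + x * (Y * (P * T)) by ring.
have -> : Y.+1 * P * (R * T) = R * (Y * (P * T)) + R * (P * T) by ring.
have -> : Y.+1 * P * (s.+1 * (Y * T))
    = s.+1 * Y * (Y * (P * T)) + s.+1 * (Y * (P * T)) by ring.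
lia.
Qed.

(** Leaving the special gap empty makes an ordinary gap the special one, in
    which all letters are allowed. *)
Lemma count_law_close (s X n N : nat) : (n = 0 -> X = 0) ->
  count_law (s + X) s N n 0 0 -> count_law (s + X).+1 s.+1 N 0 n X.
Proof.
rewrite /count_law !expn0 !mul0n !muln0 !addn0 !muln1 !mul1n.
case: n => [/(_ erefl) -> | n _] /=.
  rewrite !addn0 !expn0 !(mul0n, mul1n, muln1, addn0) -{2}[s.+1]mul1n => /eqP.
  by rewrite eqn_pmul2r // => /eqP ->; rewrite mul1n.
rewrite expnS -mulnA mulnC => /eqP; rewrite eqn_pmul2l // => /eqP ->.
ring.
Qed.

Lemma sum_eq_cond (F : nat -> nat) (A : seq nat) (P Q : pred nat) :
  {in A, P =1 Q} -> \sum_(b <- A | P b) F b = \sum_(b <- A | Q b) F b.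
Proof. by move=> PQ; rewrite -big_filter -[RHS]big_filter (eq_in_filter PQ). Qed.

(** Summation of the law over the last letter of the special gap: raising the
    threshold by one admits at most one more letter [a], and the words ending
    in [a] may use at top level, besides [a], exactly the letters of smaller
    key. *)
Lemma count_law_threshold (key x g : nat -> nat) (A : seq nat) (Y s N t : nat) :
  uniq A -> {in A &, injective key} ->
  count_law Y s N 0 (size A) (\sum_(b <- A) x b) ->
  (forall a : nat, a \in A ->
    count_law Y (s + x a) (g a) (count (fun b => key b < key a) (rem a A))
      (count (fun b => key a <= key b) (rem a A))
      (\sum_(b <- rem a A | key a <= key b) x b)) ->
  count_law Y s (N + \sum_(a <- A | key a < t) g a)
    (count (fun b => key b < t) A) (count (fun b => t <= key b) A)
    (\sum_(b <- A | t <= key b) x b).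
Proof.
move=> uA inj base step; elim: t => [|t IH].
  rewrite big_pred0 // addn0 (@eq_count _ _ pred0) // count_pred0.
  by rewrite (@eq_count _ _ predT) // count_predT.
(* [key] is injective on [A], so at most one letter has key [t]. *)
have [/hasP[a aA /eqP kat] | /hasPn nt] := boolP (has (fun a => key a == t) A).
- have pA := perm_to_rem aA.
  have neq b : b \in rem a A -> key b != t.
    rewrite mem_rem_uniq // inE => /andP[ba bA]; apply: contra ba => /eqP kbt.
    by apply/eqP/inj; rewrite // kbt.
  have := step a aA; move: IH; rewrite kat.
  rewrite !(perm_big _ pA) /= !big_cons !(permP pA) /= kat !(ltnSn, ltnn, leqnn).
  have lt b : b \in rem a A -> (key b < t.+1) = (key b < t).
    by move=> /neq; lia.
  have ge b : b \in rem a A -> (t < key b) = (t <= key b).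
    by move=> /neq; lia.
  rewrite (eq_in_count lt) (eq_in_count ge) !add0n !add1n.
  rewrite (sum_eq_cond g lt) (sum_eq_cond x ge).
  rewrite [X in count_law _ _ _ _ _ X]addnC => lawt lawa.
  rewrite addnCA addnC; apply: count_law_add lawt lawa.
  move/eqP; rewrite -leqn0 leqNgt -has_count => /hasPn nq.
  by rewrite big_seq_cond big1 // => b /andP[/nq/negPf ->].
- have lt b : b \in A -> (key b < t.+1) = (key b < t).
    by move=> /nt; lia.
  have ge b : b \in A -> (t < key b) = (t <= key b).
    by move=> /nt; lia.
  by rewrite (sum_eq_cond g lt) (sum_eq_cond x ge) (eq_in_count lt) (eq_in_count ge).
Qed.

(** The rank of [a] in the cyclic descent c-1, ..., 0, M-1, ..., c; the letter
    [c] itself comes last, at rank [M]. *)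
Definition drop_key (M c a : nat) : nat := if a < c then c - a else c + M - a.

Lemma descending_key (M c a m : nat) : a < M -> m < M -> a != c -> a != m ->
  descending c a m = (drop_key M c a < drop_key M c m).
Proof.
rewrite /descending /drop_key => aM mM ac am.
by case: (ltnP a c); case: (ltnP m a); case: (ltnP m c); lia.
Qed.

Lemma drop_key_inj (M c : nat) : {in gtn M &, injective (drop_key M c)}.
Proof.
move=> a b; rewrite !inE /drop_key => aM bM.
by case: (ltnP a c); case: (ltnP b c); lia.
Qed.

Lemma drop_key_self (M c a : nat) : a < M -> c < M -> a != c ->
  drop_key M c a < drop_key M c c.
Proof. by move=> aM cM ac; rewrite /drop_key ltnn; case: (ltnP a c); lia. Qed.

(** Gaps with equal ends admit all letters at their top level, so along the
    recursion of [max_fillings] at most the first gap is restricted. *)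
Lemma size_max_fillings (k : nat -> nat) (M f c m : nat) (gs : seq (nat * nat)) (A : seq nat) :
  uniq A -> (forall a : nat, a \in A -> 0 < k a) ->
  weight k ((c, m) :: gs) A <= f ->
  (forall a : nat, a \in A -> a < M) -> c < M -> m < M -> c \notin A -> m \notin A ->
  (forall g : nat * nat, g \in gs -> [/\ g.1 = g.2, g.1 < M & g.1 \notin A]) ->
  count_law (size gs + \sum_(a <- A) (k a).-1) (size gs)
    (size (max_fillings k f ((c, m) :: gs) A))
    (count (fun b => drop_key M c b < drop_key M c m) A)
    (count (fun b => drop_key M c m <= drop_key M c b) A)
    (\sum_(b <- A | drop_key M c m <= drop_key M c b) (k b).-1).
Proof.
elim: f c m gs A => [|f IH] c m gs A uA kA lef AM cM mM cA mA full; first by [].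
have neq (a b : nat) (B : seq nat) : a \in B -> b \notin B -> a != b.
  by move=> aB; apply: contraNneq => <-.
have lt_a a : a \in A -> descending c a m = (drop_key M c a < drop_key M c m).
  move=> aA; apply: descending_key => //; [exact: AM | |];
    exact: (neq _ _ A).
rewrite [max_fillings _ _ _ _]/= size_cat size_map size_allpairs_dep sumnE big_map big_filter.
rewrite (sum_eq_cond _ lt_a); apply: count_law_threshold => //.
- move=> a b aA bA; apply: drop_key_inj; rewrite inE; exact: AM.
- case: gs lef full => [|[d d'] gs] lef full.
    rewrite /count_law add0n; case: A uA kA {lef AM cA mA full IH lt_a} => [|a A] uA kA.
      by rewrite big_nil; case: (f).
    have -> : max_fillings k f [::] (a :: A) = [::] by case: (f).
    by rewrite mul0n add0n !expn0 !mul1n -expnS.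
  have [/= dd' dM dA] := full (d, d') (mem_head _ _); rewrite -dd' in lef *.
  have := IH d d gs A uA kA lef AM dM dM dA dA.
  have full' g : g \in gs -> [/\ g.1 = g.2, g.1 < M & g.1 \notin A].
    by move=> ggs; apply: full; rewrite inE ggs orbT.
  move=> /(_ full').
  have allt a : a \in A -> drop_key M d a < drop_key M d d.
    by move=> aA; apply: drop_key_self => //; [exact: AM | exact: (neq _ _ A)].
  have nogt a : a \in A -> (drop_key M d d <= drop_key M d a) = false.
    by move=> /allt; lia.
  have -> : \sum_(b <- A | drop_key M d d <= drop_key M d b) (k b).-1 = 0.
    by rewrite (sum_eq_cond _ nogt) big_pred0_eq.
  have -> : count (fun b => drop_key M d d <= drop_key M d b) A = 0.
    by rewrite (eq_in_count nogt) count_pred0.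
  have -> : count (fun b => drop_key M d b < drop_key M d d) A = size A.
    by apply/eqP; rewrite -all_count; apply/allP.
  rewrite addSn; apply: count_law_close.
  by move/size0nil ->; rewrite big_nil.
- move=> a aA; have ka := kA a aA; have aM := AM a aA.
  have := IH c a (nseq (k a).-1 (a, a) ++ gs) (rem a A) (rem_uniq a uA).
  rewrite -ltnS -(weight_open c m gs ka aA).
  have arA : a \notin rem a A by rewrite mem_rem_uniq // inE eqxx.
  have crA : c \notin rem a A by apply: contra cA => /mem_rem.
  have kr b : b \in rem a A -> 0 < k b by move/mem_rem/kA.
  have AMr b : b \in rem a A -> b < M by move/mem_rem/AM.
  move=> /(_ kr lef AMr cM aM crA arA).
  rewrite size_cat size_nseq (big_rem a aA) /= [_ + size gs]addnC addnA.
  apply=> g; rewrite mem_cat mem_nseq => /orP[/andP[_ /eqP ->] //|/full[g12 gM gA]].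
  by split=> //; apply: contra gA => /mem_rem.
Qed.

(** * Permutations of the multiset *)

Definition multiplicity (n : nat) (k : 'I_n -> nat) (a : nat) : nat :=
  oapp k 0 (insub a.-1).

Lemma multiplicityE (n : nat) (k : 'I_n -> nat) (i : 'I_n) : multiplicity k i.+1 = k i.
Proof. by rewrite /multiplicity /= valK. Qed.

Lemma big_letters (n : nat) (F : nat -> nat) :
  \sum_(a <- iota 1 n) F a = \sum_(i < n) F i.+1.
Proof.
rewrite (iotaDl 1 0) big_map -(big_mkord xpredT (fun i => F i.+1)).
by rewrite /index_iota subn0.
Qed.

Lemma count_multiset_word (n : nat) (k : 'I_n -> nat) (x : nat) :
  count_mem x (multiset_word k) = if x \in iota 1 n then multiplicity k x else 0.
Proof.
rewrite /multiset_word count_flatten -map_comp sumnE big_map big_enum /=.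
under eq_bigr => i _ do rewrite count_nseq /=.
case: ifP; rewrite mem_iota => xn.
- have [x0 lt_x] : 0 < x /\ x.-1 < n by lia.
  rewrite (bigD1 (Ordinal lt_x)) //= prednK // eqxx mul1n big1 ?addn0.
    by rewrite -{2}(prednK x0) (multiplicityE k (Ordinal lt_x)).
  move=> i; rewrite -val_eqE /= => ix; case: eqP => // ixE.
  by rewrite -ixE eqxx in ix.
- rewrite big1 // => i _; case: eqP => // ixE; move: xn (ltn_ord i); lia.
Qed.

Lemma size_max_fillings_root (n : nat) (k : nat -> nat) (f : nat) :
  0 < n -> (forall a : nat, a \in iota 1 n -> 0 < k a) ->
  weight k [:: (0, 0)] (iota 1 n) <= f ->
  size (max_fillings k f [:: (0, 0)] (iota 1 n))
  = (\sum_(a <- iota 1 n) (k a).-1).+1 ^ n.-1.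
Proof.
move=> n0 kA lef.
have A0 : 0 \notin iota 1 n by rewrite mem_iota.
have AM a : a \in iota 1 n -> a < n.+1 by rewrite mem_iota; lia.
have full (g : nat * nat) : g \in [::] ->
    [/\ g.1 = g.2, g.1 < n.+1 & g.1 \notin iota 1 n] by [].
have := size_max_fillings (iota_uniq 1 n) kA lef AM (ltn0Sn n) (ltn0Sn n) A0 A0 full.
have lt a : a \in iota 1 n -> drop_key n.+1 0 a < drop_key n.+1 0 0.
  move=> aA; apply: drop_key_self => //; first exact: AM.
  by apply: contraNneq A0 => a0; rewrite -{1}a0.
have nge a : a \in iota 1 n -> (drop_key n.+1 0 0 <= drop_key n.+1 0 a) = false.
  by move=> /lt; lia.
have -> : \sum_(b <- iota 1 n | drop_key n.+1 0 0 <= drop_key n.+1 0 b) (k b).-1 = 0.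
  by rewrite (sum_eq_cond _ nge) big_pred0_eq.
have -> : count (fun b => drop_key n.+1 0 0 <= drop_key n.+1 0 b) (iota 1 n) = 0.
  by rewrite (eq_in_count nge) count_pred0.
have -> : count (fun b => drop_key n.+1 0 b < drop_key n.+1 0 0) (iota 1 n) = n.
  by rewrite -[RHS](size_iota 1 n); apply/eqP; rewrite -all_count; apply/allP.
rewrite /count_law add0n mul0n muln0 addn0 expn0 !muln1.
move: (size (max_fillings _ _ _ _)) (\sum_(a <- _) _) => N X.
by rewrite -{1}(prednK n0) expnSr => /eqP; rewrite eqn_pmul2r // => /eqP.
Qed.

Theorem corollary1p4 (n : nat) (k : 'I_n -> nat)
    (hn : 1 <= n) (hk : forall i : 'I_n, 1 <= k i) :
  let K := \sum_(i < n) k i in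
  size [seq w <- quasi_stirling_permutations k | des w == n]
  = (K - n + 1) ^ (n - 1).
Proof.
move=> K.
have kA a : a \in iota 1 n -> 0 < multiplicity k a.
  rewrite mem_iota => an; have lt_a : a.-1 < n by lia.
  have -> : a = (Ordinal lt_a).+1 by rewrite /=; lia.
  by rewrite multiplicityE.
pose f := weight (multiplicity k) [:: (0, 0)] (iota 1 n).
have -> : K - n + 1 = (\sum_(a <- iota 1 n) (multiplicity k a).-1).+1.
  rewrite big_letters addn1; congr _.+1; apply/eqP.
  rewrite -(eqn_add2r n) subnK; last first.
    by rewrite -[X in X <= _]card_ord -sum1_card; apply: leq_sum.
  rewrite -[X in _ == _ + X]card_ord -sum1_card -big_split /=; apply/eqP.
  by apply: eq_bigr => i _; rewrite multiplicityE addn1 prednK.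
rewrite subn1 -(size_max_fillings_root hn kA (leqnn f)).
rewrite -(size_map (cons^~ [::])); apply/perm_size/uniq_perm.
- rewrite map_inj_uniq; last by move=> u v [].
  by do 2!apply: filter_uniq; apply: permutations_uniq.
- exact: max_fillings_uniq (iota_uniq 1 n) kA (leqnn f).
have memE w : ([:: w] \in max_fillings (multiplicity k) f [:: (0, 0)] (iota 1 n)) =
    (w \in [seq w <- quasi_stirling_permutations k | des w == n]).
  rewrite mem_filter mem_filter mem_permutations desE.
  apply/idP/idP.
  - case/(mem_max_fillings _ (iota_uniq 1 n) kA (leqnn f)) => _ [cnt qs _].
    rewrite gap_des_cons base_des_cons size_iota /gap_des /base_des !big_nil !addn0.
    move=> ->; rewrite eqxx /=; rewrite /= andbT in qs; rewrite qs.
    apply/allP => x _; rewrite /= count_multiset_word -cnt /= cats0 //.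
  - case/and3P=> /eqP dE qs pw; apply/(mem_max_fillings _ (iota_uniq 1 n) kA (leqnn f)).
    split=> //; last first.
      by rewrite gap_des_cons base_des_cons size_iota /gap_des /base_des !big_nil dE !addn0.
    split; rewrite ?andbT //= ?qs // => x.
    by rewrite cats0 -count_multiset_word; apply/permP.
move=> us; apply/mapP/idP => [[w win ->]|]; first by rewrite memE.
move=> usg; have [szus _ _] := (mem_max_fillings us (iota_uniq 1 n) kA (leqnn f)).1 usg.
case: us szus usg => [|w [|v us]] // _; rewrite memE; by exists w.
Qed.
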